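(* Let $m=nq+s$ with integers $q\ge1$ and $0<s<n$. Let $P_n(x)=\sum_{i}a_ix^i$ be a monic polynomial of degree $n$ and $Q_m(x)=\sum_{j=0}^mb_jx^j$ a polynomial of degree $m$ in $\mathbb{C}[x]$, and let $A$ be the Airy connection associated with $(P_n,Q_m)$, i.e. the $n\times n$ matrix $$A=\begin{pmatrix}0&z^{-2}&0&\cdots&0\\0&0&z^{-2}&\cdots&0\\ \vdots&&&\ddots&\vdots\\0&0&0&\cdots&z^{-2}\\ z^{-2}Q_m(\tfrac1z)&a_1z^{-2}&a_2z^{-2}&\cdots&a_{n-1}z^{-2}\end{pmatrix}.$$ Then there exists $U\in GL(n,\overline{\mathcal{F}})$ such that $$U[A]=B=\operatorname{diag}(q_1(z),\dots,q_n(z))+\frac{1-n}{2n}(n+m)\,z^{-1}I,$$ where $q_1,\dots,q_n$ are polynomials in $z^{-1/n}$ of degree $m+2n$ whose coefficients are functions of $a_{n-1},b_m,b_{m-1},\dots,b_{m-(q+1)}$.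
   Context: $\mathcal{F}=\mathbb{C}((z))$ is the field of formal Laurent series and $\overline{\mathcal{F}}=\bigcup_{b\ge1}\mathcal{F}(z^{1/b})$ is its algebraic closure (field of Puiseux series), with the derivation $'=\frac{d}{dz}$. For $\xi\in GL(n,\overline{\mathcal{F}})$ and a connection matrix $A\in\mathfrak{gl}(n,\overline{\mathcal{F}})$, the gauge transform is $\xi[A]=\xi A\xi^{-1}+\xi'\xi^{-1}$. $I$ is the identity matrix. *)

(* Defs.v *)
(* Puiseux series over a field, gauge transformations of connection matrices, and
   the connection matrix of the Airy equation of a pair of polynomials. *)
From HB Require Import structures.
From mathcomp Require Import all_boot all_order all_algebra.
From mathcomp Require Import boolp classical_sets fsbigop reals.
From mathcomp Require Import complex.

Set Implicit Arguments.
Unset Strict Implicit.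
Unset Printing Implicit Defensive.

Import Order.TTheory GRing.Theory Num.Theory.
Local Open Scope ring_scope.

Section PuiseuxSupport.
Variable K : fieldType.
Implicit Types (f g h : rat -> K) (b : nat) (N : int).

Definition supp_ge b N f :=
  forall r, f r != 0 -> exists2 k : int, N <= k & r = k%:~R / b%:R.

(* A function f : rat -> K stands for the formal sum of the f r * z^r. It is a
   Puiseux series, i.e. an element of K((z^(1/b))) for some b, when its support
   lies in {k / b | k >= N} for some N. *)
Definition is_puiseux f := exists b N, (0 < b)%N /\ supp_ge b N f.

(* Coefficient of z^r in a product. For Puiseux series only finitely many terms
   are nonzero (conv_finite); otherwise \sum_(a \in _) would default to 0. *)
Definition conv f g : rat -> K := fun r => \sum_(a \in [set: rat]) f a * g (r - a).

Lemma supp_ge_le b M N f : M <= N -> supp_ge b N f -> supp_ge b M f.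
Proof. by move=> MN sf r /sf [k Nk ->]; exists k => //; apply: le_trans Nk. Qed.

Lemma supp_ge_mul b c N f : (0 < b)%N -> (0 < c)%N ->
  supp_ge b N f -> supp_ge (b * c) (N * c%:Z) f.
Proof.
move=> b0 c0 sf r /sf [k Nk ->]; exists (k * c%:Z).
  by rewrite ler_wpM2r.
have cn0 : c%:R != 0 :> rat by rewrite pnatr_eq0 -lt0n.
by rewrite intrM natrM -mulf_div divff // mulr1.
Qed.

Lemma is_puiseux2 f g : is_puiseux f -> is_puiseux g ->
  exists b N, [/\ (0 < b)%N, supp_ge b N f & supp_ge b N g].
Proof.
move=> [b [N [b0 sf]]] [c [M [c0 sg]]].
exists (b * c)%N, (Num.min (N * c%:Z) (M * b%:Z)); split.
- by rewrite muln_gt0 b0.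
- by apply: supp_ge_le (supp_ge_mul b0 c0 sf); rewrite ge_min lexx.
- by rewrite mulnC; apply: supp_ge_le (supp_ge_mul c0 b0 sg); rewrite ge_min lexx orbT.
Qed.

Lemma is_puiseux3 f g h : is_puiseux f -> is_puiseux g -> is_puiseux h ->
  exists b N, [/\ (0 < b)%N, supp_ge b N f, supp_ge b N g & supp_ge b N h].
Proof.
move=> pf pg [c [M [c0 sh]]]; have [b [N [b0 sf sg]]] := is_puiseux2 pf pg.
exists (b * c)%N, (Num.min (N * c%:Z) (M * b%:Z)); split.
- by rewrite muln_gt0 b0.
- by apply: supp_ge_le (supp_ge_mul b0 c0 sf); rewrite ge_min lexx.
- by apply: supp_ge_le (supp_ge_mul b0 c0 sg); rewrite ge_min lexx.
- by rewrite mulnC; apply: supp_ge_le (supp_ge_mul c0 b0 sh); rewrite ge_min lexx orbT.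
Qed.

Lemma grid_exists b N (t : rat) : (0 < b)%N ->
  exists2 s : seq rat, uniq s &
    forall k : int, N <= k -> k%:~R / b%:R <= t -> k%:~R / b%:R \in s.
Proof.
move=> b0; have b0' : 0 < b%:R :> rat by rewrite ltr0n.
exists (undup [seq (N + i%:Z)%:~R / b%:R
              | i <- iota 0 `|(Num.floor (t * b%:R) - N)%R|.+1]); first exact: undup_uniq.
move=> k Nk; rewrite ler_pdivrMr // -floor_ge_int => kt.
rewrite mem_undup; apply/mapP; exists `|(k - N)%R|%N.
  rewrite mem_iota /= add0n ltnS -lez_nat !gez0_abs ?subr_ge0 //.
    by rewrite lerD2r.
  exact: le_trans kt.
by rewrite gez0_abs ?subr_ge0 // subrKC.
Qed.

Lemma conv_seq f g r (s : seq rat) : uniq s ->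
  (forall a, f a != 0 -> g (r - a) != 0 -> a \in s) ->
  conv f g r = \sum_(a <- s) f a * g (r - a).
Proof.
move=> us sP; rewrite /conv (@fsbigE _ _ _ _ _ s) //.
  by apply: eq_bigl => a; rewrite in_setT.
move=> a _; apply: contraNeq; rewrite mulf_eq0 negb_or => /andP[? ?].
exact: sP.
Qed.

Lemma conv_finite f g r : is_puiseux f -> is_puiseux g ->
  exists2 s : seq rat, uniq s &
    forall a, f a != 0 -> g (r - a) != 0 -> a \in s.
Proof.
move=> pf pg; have [b [N [b0 sf sg]]] := is_puiseux2 pf pg.
have [s us sP] := grid_exists N (r - N%:~R / b%:R) b0; exists s => // a fa ga.
have [k Nk ak] := sf _ fa; rewrite ak; apply: sP => //; rewrite -ak.
have [l Nl al] := sg _ ga.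
have -> : a = r - (r - a) by rewrite subKr.
by rewrite lerD2l lerN2 al ler_pM2r ?invr_gt0 ?ltr0n // ler_int.
Qed.

Lemma conv_neq0 f g r : conv f g r != 0 -> exists2 a, f a != 0 & g (r - a) != 0.
Proof.
move=> nz; apply: contrapT => nex; move/eqP: nz; apply.
apply: fsbig1 => a _; apply/eqP; rewrite mulf_eq0 -[_ || _]negbK negb_or.
by apply/negP => /andP[fa ga]; apply: nex; exists a.
Qed.

Lemma supp_ge_conv b M N f g :
  supp_ge b M f -> supp_ge b N g -> supp_ge b (M + N) (conv f g).
Proof.
move=> sf sg r /conv_neq0 [a /sf [k Mk ->] /sg [l Nl rl]].
exists (k + l); first exact: lerD.
by rewrite -[r](subrK (k%:~R / b%:R)) rl -mulrDl -intrD addrC.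
Qed.

Lemma convC f g : is_puiseux f -> is_puiseux g -> conv f g = conv g f.
Proof.
move=> pf pg; apply: funext => r; have [s us sP] := conv_finite r pf pg.
have inj : injective (fun a : rat => r - a) by move=> a c /addrI /oppr_inj.
rewrite (conv_seq us sP) (@conv_seq g f r [seq r - a | a <- s]) ?map_inj_uniq //.
  by rewrite big_map; apply: eq_bigr => a _; rewrite subKr mulrC.
move=> a ga fa; apply/mapP; exists (r - a); last by rewrite subKr.
by apply: sP => //; rewrite subKr.
Qed.

Lemma convA f g h : is_puiseux f -> is_puiseux g -> is_puiseux h ->
  conv f (conv g h) = conv (conv f g) h.
Proof.
move=> pf pg ph; have [b [N [b0 sf sg sh]]] := is_puiseux3 pf pg ph.
apply: funext => r; have b0' : 0 < b%:R^-1 :> rat by rewrite invr_gt0 ltr0n.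
have [s us sP] := grid_exists (N + N) (r - N%:~R / b%:R) b0.
have [s' us' sP'] := grid_exists N (r - (N + N)%:~R / b%:R) b0.
have bound f1 (M : int) (a : rat) : supp_ge b M f1 -> f1 (r - a) != 0 -> a <= r - M%:~R / b%:R.
  move=> s1 /s1 [l Ml al]; have -> : a = r - (r - a) by rewrite subKr.
  by rewrite lerD2l lerN2 al ler_pM2r // ler_int.
rewrite (@conv_seq f (conv g h) r s') //; last first.
  move=> a fa ga; have [k Nk ak] := sf _ fa; rewrite ak; apply: sP' => //; rewrite -ak.
  exact: bound (supp_ge_conv sg sh) ga.
rewrite (@conv_seq (conv f g) h r s) //; last first.
  move=> a fa ga; have [k Nk ak] := supp_ge_conv sf sg fa.
  by rewrite ak; apply: sP => //; rewrite -ak; apply: bound ga.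
transitivity (\sum_(a <- s') \sum_(c <- s) f a * g (c - a) * h (r - c)); last first.
  rewrite exchange_big; apply: eq_bigr => c _.
  have [->|hc] := eqVneq (h (r - c)) 0.
    by rewrite mulr0 big1 // => a _; rewrite mulr0.
  rewrite (@conv_seq f g c s') ?mulr_suml // => a fa ga.
  have [k Nk ak] := sf _ fa; have [l Nl al] := sg _ ga.
  rewrite ak; apply: sP' => //; rewrite -ak.
  have -> : a = c - (c - a) by rewrite subKr.
  have -> : r - (N + N)%:~R / b%:R = r - N%:~R / b%:R - N%:~R / b%:R.
    by rewrite intrD mulrDl opprD addrA.
  by apply: lerB; [exact: bound sh hc | rewrite al ler_pM2r // ler_int].
apply: eq_bigr => a _; have [->|fa] := eqVneq (f a) 0.
  by rewrite mul0r big1 // => c _; rewrite !mul0r.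
have inj : injective (fun c : rat => c - a) by move=> c d /addIr.
rewrite (@conv_seq g h (r - a) [seq c - a | c <- s]) ?map_inj_uniq //.
  rewrite big_map mulr_sumr; apply: eq_bigr => c _.
  have -> : r - a - (c - a) = r - c by rewrite opprB addrA subrK.
  by rewrite mulrA.
move=> d gd hd; apply/mapP; exists (a + d); last by rewrite addrC addKr.
have [k Nk ak] := sf _ fa; have [l Nl al] := sg _ gd.
have ad : a + d = (k + l)%:~R / b%:R by rewrite ak al -mulrDl -intrD.
rewrite ad; apply: sP; first exact: lerD.
by rewrite -ad; apply: bound sh _; rewrite opprD addrA.
Qed.

Lemma convDl f g h : is_puiseux f -> is_puiseux g -> is_puiseux h ->
  conv (fun r => f r + g r) h = fun r => conv f h r + conv g h r.
Proof.
move=> pf pg ph; apply: funext => r.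
have [s us sP] := conv_finite r pf ph; have [t ut tP] := conv_finite r pg ph.
have fgP a : (f a != 0) || (g a != 0) -> h (r - a) != 0 -> a \in undup (s ++ t).
  rewrite mem_undup mem_cat => /orP[fa|ga] ha; first by rewrite sP.
  by rewrite tP ?orbT.
rewrite !(@conv_seq _ _ _ (undup (s ++ t))) ?undup_uniq //.
- by rewrite -big_split; apply: eq_bigr => a _; rewrite mulrDl.
- by move=> a ga; apply: fgP; rewrite ga orbT.
- by move=> a fa; apply: fgP; rewrite fa.
move=> a fga; apply: fgP; rewrite -negb_and; apply: contraNN fga.
by move=> /andP[/eqP-> /eqP->]; rewrite addr0.
Qed.

Definition delta (r : rat) (c : K) : rat -> K := fun a => if a == r then c else 0.

Lemma conv_delta r c f : conv (delta r c) f = fun a => c * f (a - r).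
Proof.
apply: funext => a; rewrite (@conv_seq _ _ _ [:: r]) //.
  by rewrite big_seq1 /delta eqxx.
by move=> x; rewrite /delta inE; case: (x == r) => //; rewrite eqxx.
Qed.

Lemma is_puiseux_delta r c : is_puiseux (delta r c).
Proof.
exists `|denq r|%N, (numq r); split; first by rewrite absz_gt0 denq_neq0.
move=> a; rewrite /delta; have [-> _|_] := eqVneq a r; last by rewrite eqxx.
by exists (numq r) => //; rewrite -[LHS]divq_num_den -[in LHS]absz_denq.
Qed.

Lemma is_puiseuxD f g : is_puiseux f -> is_puiseux g -> is_puiseux (fun r => f r + g r).
Proof.
move=> pf pg; have [b [N [b0 sf sg]]] := is_puiseux2 pf pg.
exists b, N; split=> // r; have [fr|fr _] := eqVneq (f r) 0; last exact: sf.
by rewrite fr add0r; apply: sg.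
Qed.

Lemma is_puiseuxN f : is_puiseux f -> is_puiseux (fun r => - f r).
Proof.
by move=> [b [N [b0 sf]]]; exists b, N; split=> // r; rewrite oppr_eq0; apply: sf.
Qed.

Lemma is_puiseux_conv f g : is_puiseux f -> is_puiseux g -> is_puiseux (conv f g).
Proof.
move=> pf pg; have [b [N [b0 sf sg]]] := is_puiseux2 pf pg.
by exists b, (N + N); split=> //; apply: supp_ge_conv.
Qed.

Lemma power_series_inverse (u : nat -> K) : u 0%N != 0 ->
  exists h : nat -> K, forall n, \sum_(i < n.+1) h i * u (n - i)%N = (n == 0%N)%:R.
Proof.
move=> u0.
pose fix hs n : seq K := if n is p.+1
  then rcons (hs p) (((p == 0%N)%:R - \sum_(i < p) (hs p)`_i * u (p - i)%N) / u 0%N)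
  else [::].
have size_hs n : size (hs n) = n by elim: n => //= n IH; rewrite size_rcons IH.
have hsE n i : (i < n)%N -> (hs n)`_i = (hs i.+1)`_i.
  elim: n => // n IH; rewrite ltnS leq_eqVlt => /orP[/eqP-> //|lt_in].
  by rewrite [LHS]/= nth_rcons size_hs lt_in IH.
have [h hE] : exists h : nat -> K, forall n,
    h n = ((n == 0%N)%:R - \sum_(i < n) h i * u (n - i)%N) / u 0%N.
  exists (fun n => (hs n.+1)`_n) => n; rewrite [LHS]/= nth_rcons size_hs ltnn eqxx.
  congr ((_ - _) / _).
  by apply: eq_bigr => i _; rewrite hsE.
by exists h => n; rewrite big_ord_recr /= subnn [h n]hE divfK // subrKC.
Qed.

Lemma conv_inverse f : is_puiseux f -> (exists r, f r != 0) ->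
  exists2 g, is_puiseux g & conv g f = delta 0 1.
Proof.
move=> [b [N [b0 sf]]] [r0 fr0].
have bn0 : b%:R != 0 :> rat by rewrite pnatr_eq0 -lt0n.
have exi : exists i : nat, f ((N + i%:Z)%:~R / b%:R) != 0.
  have [k Nk rk] := sf _ fr0; exists `|(k - N)%R|%N.
  by rewrite gez0_abs ?subr_ge0 // subrKC -rk.
case: (ex_minnP exi) => m fm minm; pose M := N + m%:Z.
have sfM : supp_ge b M f.
  move=> r fr; have [k Nk rk] := sf _ fr; exists k => //.
  rewrite /M addrC -lerBrDr -[k - N]gez0_abs ?subr_ge0 // lez_nat; apply: minm.
  by rewrite gez0_abs ?subr_ge0 // subrKC -rk.
pose u i := f ((M + i%:Z)%:~R / b%:R).
have [|h hP] := @power_series_inverse u; first by rewrite /u addr0.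
pose g (r : rat) : K := let x := r * b%:R + M%:~R in
  if x \is a Num.nat then h (Num.truncn x) else 0.
have gE (i : nat) : g ((i%:Z - M)%:~R / b%:R) = h i.
  by rewrite /g divfK // intrB subrK /= natr_nat natrK.
have sg : supp_ge b (- M) g.
  move=> r; rewrite /g /=; case: ifP => [/natrP [i ri] _|]; last by rewrite eqxx.
  exists (i%:Z - M); first by rewrite lerDr.
  by rewrite intrB -[X in X - _]/(i%:R) -ri addrK mulfK.
exists g; first by exists b, (- M).
apply: funext => r; rewrite /delta.
have [[n rn]|nr] := pselect (exists n : nat, r = n%:R / b%:R); last first.
  have -> : (r == 0) = false.
    by apply/eqP => r00; apply: nr; exists 0%N; rewrite mul0r.
  apply/eqP; rewrite -[_ == _]negbK; apply/negP => nz; apply: nr.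
  have [k] := supp_ge_conv sg sfM nz.
  by rewrite addNr; case: k => // n _ ->; exists n.
have -> : (if r == 0 then 1 else 0) = (n == 0%N)%:R :> K.
  by rewrite rn mulf_eq0 invr_eq0 (negPf bn0) orbF pnatr_eq0; case: eqP.
pose a_ (i : nat) : rat := (i%:Z - M)%:~R / b%:R.
have a_inj : injective a_.
  by move=> i j /(mulIf (invr_neq0 bn0)) /eqP; rewrite eqr_int => /eqP /addIr [].
rewrite -hP (@conv_seq g f r [seq a_ i | i <- iota 0 n.+1]) ?map_inj_uniq ?iota_uniq //.
  rewrite big_map -[iota 0 n.+1]/(index_iota 0 n.+1) big_mkord; apply: eq_bigr => i _.
  rewrite gE /u; congr (_ * f _); rewrite rn -mulrBl; congr (_ / _).
  have le_in : (i <= n)%N by rewrite -ltnS.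
  by rewrite -subzn // [RHS]intrD !intrB opprB addrCA.
move=> a ga fa; have [k Mk ak] := sg _ ga; have [l Ml al] := sfM _ fa.
have kM : 0 <= k + M by rewrite -lerBlDr sub0r.
apply/mapP; exists `|(k + M)%R|%N; last by rewrite /a_ gez0_abs // addrK.
rewrite mem_iota /= add0n ltnS -lez_nat gez0_abs //.
have : r = (k + l)%:~R / b%:R.
  by rewrite -[r](subrK a) al ak -mulrDl -intrD addrC.
rewrite rn => /(mulIf (invr_neq0 bn0)) /eqP; rewrite -[n%:R]/(n%:Z%:~R) eqr_int => /eqP->.
by rewrite lerD2l.
Qed.

End PuiseuxSupport.

Record puiseux (K : fieldType) := Puiseux {
  pcoef : rat -> K;
  pcoefP : is_puiseux pcoef
}.

HB.instance Definition _ (K : fieldType) := gen_eqMixin (puiseux K).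
HB.instance Definition _ (K : fieldType) := gen_choiceMixin (puiseux K).

Section PuiseuxField.
Variable K : fieldType.
Implicit Types f g h : puiseux K.

Lemma puiseux_ext f g : pcoef f =1 pcoef g -> f = g.
Proof.
case: f g => [f pf] [g pg] /= /funext fg; rewrite fg in pf *.
by rewrite (Prop_irrelevance pf pg).
Qed.

(* c * z^r *)
Definition pmonom (c : K) (r : rat) := Puiseux (is_puiseux_delta r c).

Definition padd f g := Puiseux (is_puiseuxD (pcoefP f) (pcoefP g)).
Definition popp f := Puiseux (is_puiseuxN (pcoefP f)).
Definition pmul f g := Puiseux (is_puiseux_conv (pcoefP f) (pcoefP g)).
Definition pinv f : puiseux K :=
  if pselect (exists g, pmul g f = pmonom 1 0) is left e
  then projT1 (cid e) else pmonom 0 0.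

Let paddA : associative padd.
Proof. by move=> f g h; apply: puiseux_ext => r /=; rewrite addrA. Qed.
Let paddC : commutative padd.
Proof. by move=> f g; apply: puiseux_ext => r /=; rewrite addrC. Qed.
Let padd0 : left_id (pmonom 0 0) padd.
Proof. by move=> f; apply: puiseux_ext => r /=; rewrite /delta if_same add0r. Qed.
Let paddN : left_inverse (pmonom 0 0) popp padd.
Proof. by move=> f; apply: puiseux_ext => r /=; rewrite /delta if_same addNr. Qed.

HB.instance Definition _ :=
  GRing.isZmodule.Build (puiseux K) paddA paddC padd0 paddN.

Let pmulA : associative pmul.
Proof.
move=> f g h; apply: puiseux_ext => r /=.
by rewrite (convA (pcoefP f) (pcoefP g) (pcoefP h)).
Qed.
Let pmulC : commutative pmul.
Proof.
by move=> f g; apply: puiseux_ext => r /=; rewrite (convC (pcoefP f) (pcoefP g)).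
Qed.
Let pmul1 : left_id (pmonom 1 0) pmul.
Proof. by move=> f; apply: puiseux_ext => r /=; rewrite conv_delta mul1r subr0. Qed.
Let pmulDl : left_distributive pmul padd.
Proof.
move=> f g h; apply: puiseux_ext => r /=.
by rewrite (convDl (pcoefP f) (pcoefP g) (pcoefP h)).
Qed.
Let pone_neq0 : pmonom 1 0 != pmonom 0 0.
Proof.
apply/eqP => /(congr1 (fun f => pcoef f 0)) /= /eqP.
by rewrite /delta eqxx oner_eq0.
Qed.

HB.instance Definition _ :=
  GRing.Zmodule_isComNzRing.Build (puiseux K) pmulA pmulC pmul1 pmulDl pone_neq0.

Let pmulV f : f != 0 -> pinv f * f = 1.
Proof.
move=> /eqP f0; rewrite /pinv; case: pselect => [e|nex].
  by case: (cid e).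
exfalso; apply: nex.
have [|g pg gf] := @conv_inverse _ _ (pcoefP f).
  apply: contrapT => fz; apply: f0; apply: puiseux_ext => r /=.
  rewrite /delta if_same; apply/eqP; rewrite -[_ == _]negbK; apply/negP => fr.
  by apply: fz; exists r.
by exists (Puiseux pg); apply: puiseux_ext => r /=; rewrite gf.
Qed.
Let pinv0 : pinv 0 = 0.
Proof.
rewrite /pinv; case: pselect => // -[g g01].
have /eqP : (1 : puiseux K) = 0 by rewrite -[RHS](mulr0 g); exact: esym g01.
by rewrite oner_eq0.
Qed.

HB.instance Definition _ := GRing.ComNzRing_isField.Build (puiseux K) pmulV pinv0.

Definition puiseuxC (c : K) : puiseux K := pmonom c 0.
Definition zpow (r : rat) : puiseux K := pmonom 1 r.

Let puiseuxC_additive : zmod_morphism puiseuxC.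
Proof.
move=> c d; apply: puiseux_ext => r /=; rewrite /delta.
by case: eqP => _; rewrite ?subr0.
Qed.
Let puiseuxC_multiplicative : monoid_morphism puiseuxC.
Proof.
split=> // c d; apply: puiseux_ext => r /=; rewrite conv_delta subr0 /delta.
by case: eqP => _; rewrite ?mulr0.
Qed.

HB.instance Definition _ :=
  GRing.isZmodMorphism.Build K (puiseux K) puiseuxC puiseuxC_additive.
HB.instance Definition _ :=
  GRing.isMonoidMorphism.Build K (puiseux K) puiseuxC puiseuxC_multiplicative.

Lemma zpow0 : zpow 0 = 1. Proof. by []. Qed.

Lemma zpowD r s : zpow (r + s) = zpow r * zpow s.
Proof.
apply: puiseux_ext => a /=; rewrite conv_delta mul1r /delta.
by rewrite subr_eq [s + r]addrC.
Qed.

End PuiseuxField.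

Section Derivation.
Variable K : numFieldType.
Implicit Types f g : puiseux K.

(* (sum_r f_r z^r)' = sum_r r f_r z^(r-1). *)
Definition deriv_coef (f : rat -> K) : rat -> K :=
  fun r => ratr (r + 1) * f (r + 1).

Lemma is_puiseux_deriv (f : rat -> K) : is_puiseux f -> is_puiseux (deriv_coef f).
Proof.
move=> [b [N [b0 sf]]]; exists b, (N - b%:Z); split=> // r.
rewrite mulf_eq0 negb_or => /andP[_ /sf [k Nk rk]].
exists (k - b%:Z); first by rewrite lerB.
by rewrite intrB mulrBl -rk divff ?addrK // pnatr_eq0 -lt0n.
Qed.

Definition pderiv f : puiseux K := Puiseux (is_puiseux_deriv (pcoefP f)).

Lemma pderiv_monom c r : pderiv (pmonom c r) = pmonom (ratr r * c) (r - 1).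
Proof.
apply: puiseux_ext => a /=; rewrite /deriv_coef /delta [a == _]eq_sym subr_eq.
by rewrite [r == _]eq_sym; have [->|_] := eqVneq (a + 1) r; rewrite ?mulr0.
Qed.

Lemma pderivD f g : pderiv (f + g) = pderiv f + pderiv g.
Proof. by apply: puiseux_ext => r /=; rewrite /deriv_coef mulrDr. Qed.

Lemma pderivM f g : pderiv (f * g) = pderiv f * g + f * pderiv g.
Proof.
apply: puiseux_ext => r /=; rewrite {1}/deriv_coef.
have [s us sP] := conv_finite (r + 1) (pcoefP f) (pcoefP g).
have inj : injective (fun a : rat => a - 1) by move=> a c /addIr.
rewrite (conv_seq us sP) (@conv_seq _ _ _ r [seq a - 1 | a <- s]) ?map_inj_uniq //.
  rewrite big_map (@conv_seq _ _ _ r s) //.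
    rewrite mulr_sumr -big_split; apply: eq_bigr => a _ /=; rewrite /deriv_coef subrK.
    have -> : r - (a - 1) = r + 1 - a by rewrite opprB addrA addrAC.
    rewrite (addrAC r (- a)) [in RHS]mulrCA.
    have -> : ratr (r + 1) = ratr a + ratr (r + 1 - a) :> K.
      by rewrite -rmorphD subrKC.
    by rewrite mulrDl; congr (_ + _); apply: mulrA.
  move=> a fa; rewrite /deriv_coef mulf_eq0 negb_or addrAC => /andP[_].
  exact: sP.
move=> a; rewrite /deriv_coef mulf_eq0 negb_or => /andP[_ fa] ga.
apply/mapP; exists (a + 1); last by rewrite addrK.
by apply: sP => //; rewrite opprD addrACA subrr addr0.
Qed.

End Derivation.

(* U[A] = U A U^-1 + U' U^-1, with U' the entrywise derivative. *)
Definition gauge (K : numFieldType) n (U A : 'M[puiseux K]_n) : 'M[puiseux K]_n :=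
  U *m A *m invmx U + map_mx (@pderiv K) U *m invmx U.

(* Indices start at 0: the superdiagonal is z^-2, and the last row is
   z^-2 (Q(1/z), a_1, ..., a_(n-1)) where P = sum_i a_i x^i. *)
Definition airy_mx (K : fieldType) n (P Q : {poly K}) : 'M[puiseux K]_n :=
  \matrix_(i < n, j < n)
    if i.+1 == n then
      zpow K (- 2) *
        (if j == 0%N :> nat then (map_poly (@puiseuxC K) Q).[zpow K (- 1)]
         else puiseuxC P`_j)
    else if j == i.+1 :> nat then zpow K (- 2) else 0.

(* Main.v *)
Require Import Defs.
From HB Require Import structures.
From mathcomp Require Import all_boot all_order all_algebra.
From mathcomp Require Import separable.
From mathcomp Require Import boolp reals complex.
From mathcomp Require Import ring zify.

Import Order.TTheory GRing.Theory Num.Theory.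
Local Open Scope ring_scope.

(** Write delta = z^2 d/dz. The matrix A is the companion matrix of the scalar
    operator L = delta^n - sum_(0 < j < n) a_j delta^j - Q(1/z). If U[A] is diagonal,
    a column of U^-1 is a vector (u, nabla u, ..., nabla^(n-1) u) with
    nabla = delta + g, where g / z^2 is the diagonal entry and u is a Puiseux series
    killed by L with delta replaced by nabla. In other words exp(int g / z^2) u is a
    formal solution of L, and n independent ones are needed.

    The exponent g is found by the WKB method. All computations take place in
    the filtration of K((z^(1/n))) by the order in z^(1/n) ([ord_ge]); there
    z^(-m/n) has order -m and delta raises orders by n, so that in
      nabla^k f = g^k f + k g^(k-1) delta f + 'C(k, 2) g^(k-2) (delta g) f + ...
    the remainder is 2 (n + m) above the leading term
    ([iter_twist_expansion]). To leading order the term of L without derivative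
    of f is g^n - a_(n-1) g^(n-1) - Q(1/z) + 'C(n, 2) g^(n-2) delta g, and its
    order has to be greater than e = n - (n - 1) m, by which n g^(n-1) delta raises
    orders. This is so for
      g = lam + a_(n-1) / n + kappa z,   lam = c z^(-m/n) S(z),
    where c^n = b_m, S is a truncated n-th root of z^m Q(1/z) / b_m, and
    kappa = (n - 1) m / (2 n) cancels the term in delta g
    ([airy_exponent_root]). As m > n, the coefficients a_j with j < n - 1 do not
    interfere, and as m < n (q + 1), it is enough to know S modulo z^(q+2): this
    is why only a_(n-1) and b_m, ..., b_(m-(q+1)) occur.

    With this g, the operator is n c^(n-1) z^(e/n) (z d/dz) up to terms of higher
    order ([airy_op_expansion]). As z d/dz multiplies z^(k/n) by k/n, which is
    nonzero for k > 0, the coefficients of u = 1 + ... are determined one after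
    the other ([euler_kernel]). The n choices of c give n columns, and up to powers
    of z the leading coefficients of their entries form a Vandermonde matrix, so
    the matrix of the columns is invertible ([unitmx_of_residues]).

    Multiplying all columns by z^rho subtracts rho / z from the diagonal, where rho is
    any rational number; this moves kappa to (1 - n)(n + m) / (2 n). *)

(** * Orders of Puiseux series and successive approximation *)

Section OrderFiltration.
Context {K : numFieldType} {b : nat} (b_gt0 : (0 < b)%N).
Implicit Types (f g : puiseux K) (M N : int).

(** The order is counted in units of 1 / b, and [supp_ge] also confines the
    support to (1/b)Z; hence an order > N is automatically >= N + 1. *)
Definition ord_ge N f := supp_ge b N (pcoef f).

Lemma pcoefD f g r : pcoef (f + g) r = pcoef f r + pcoef g r.
Proof. by []. Qed.

Lemma pcoefN f r : pcoef (- f) r = - pcoef f r.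
Proof. by []. Qed.

Lemma pcoef_puiseuxC_mul c f r : pcoef (puiseuxC c * f) r = c * pcoef f r.
Proof. by rewrite [LHS]/= conv_delta subr0. Qed.

Lemma pcoef_zpow r s : pcoef (zpow K r) s = (s == r)%:R.
Proof. by rewrite /= /delta; case: eqP. Qed.

Lemma pmonomE (c : K) r : pmonom c r = puiseuxC c * zpow K r.
Proof.
apply: puiseux_ext => s; rewrite pcoef_puiseuxC_mul pcoef_zpow /= /delta.
by case: eqP; rewrite ?mulr1 ?mulr0.
Qed.

Lemma zpowX r k : zpow K r ^+ k = zpow K (k%:R * r).
Proof.
elim: k => [|k IH]; first by rewrite mul0r zpow0.
by rewrite exprS IH -zpowD -[k.+1]add1n natrD mulrDl mul1r.
Qed.

Lemma pderiv_zpow r : pderiv (zpow K r) = puiseuxC (ratr r) * zpow K (r - 1).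
Proof. by rewrite pderiv_monom pmonomE mulr1. Qed.

Lemma pderiv_puiseuxC (c : K) : pderiv (puiseuxC c) = 0.
Proof. by rewrite pderiv_monom rmorph0 mul0r pmonomE rmorph0 mul0r. Qed.

Lemma pderiv0 : pderiv (0 : puiseux K) = 0.
Proof. by rewrite -(rmorph0 (@puiseuxC K)) pderiv_puiseuxC. Qed.

Lemma pderivN f : pderiv (- f) = - pderiv f.
Proof. by apply/eqP; rewrite -subr_eq0 opprK -pderivD addNr pderiv0. Qed.

Lemma pderivB f g : pderiv (f - g) = pderiv f - pderiv g.
Proof. by rewrite pderivD pderivN. Qed.

Lemma ord_ge_le {M N f} : M <= N -> ord_ge N f -> ord_ge M f.
Proof. exact: supp_ge_le. Qed.

Lemma ord_geD {N f g} : ord_ge N f -> ord_ge N g -> ord_ge N (f + g).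
Proof.
move=> of_ og r; rewrite pcoefD; have [->|fr _] := eqVneq (pcoef f r) 0.
  by rewrite add0r; exact: og.
exact: of_.
Qed.

Lemma ord_geN {N f} : ord_ge N f -> ord_ge N (- f).
Proof. by move=> of_ r; rewrite pcoefN oppr_eq0; exact: of_. Qed.

Lemma ord_geB {N f g} : ord_ge N f -> ord_ge N g -> ord_ge N (f - g).
Proof. by move=> of_ og; apply: ord_geD => //; apply: ord_geN. Qed.

Lemma ord_ge0 N : ord_ge N 0.
Proof. by move=> r; rewrite /= /delta if_same eqxx. Qed.

Lemma ord_ge_sum N (I : Type) (s : seq I) (P : pred I) (F : I -> puiseux K) :
  (forall i, P i -> ord_ge N (F i)) -> ord_ge N (\sum_(i <- s | P i) F i).
Proof.
move=> oF; elim/big_ind: _ => //; [exact: ord_ge0|move=> f g; exact: ord_geD].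
Qed.

Lemma ord_geM {M N f g} : ord_ge M f -> ord_ge N g -> ord_ge (M + N) (f * g).
Proof. exact: supp_ge_conv. Qed.

Lemma ord_ge_zpow N : ord_ge N (zpow K (N%:~R / b%:R)).
Proof.
move=> r; rewrite pcoef_zpow; have [-> _|_] := eqVneq r (N%:~R / b%:R).
  by exists N.
by rewrite eqxx.
Qed.

Lemma ord_ge_puiseuxC (c : K) : ord_ge 0 (puiseuxC c).
Proof.
move=> r; rewrite /= /delta; have [-> _|_] := eqVneq r 0; last by rewrite eqxx.
by exists 0; rewrite ?mul0r.
Qed.

Lemma ord_geCM {N} (c : K) {f} : ord_ge N f -> ord_ge N (puiseuxC c * f).
Proof. by move=> of_; rewrite -[N]add0r; apply: ord_geM => //; exact: ord_ge_puiseuxC. Qed.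

Lemma ord_ge_natM {N} k {f} : ord_ge N f -> ord_ge N (k%:R * f).
Proof. by rewrite -(rmorph_nat (@puiseuxC K)); apply: ord_geCM. Qed.

Lemma ord_geX {M f} k : ord_ge M f -> ord_ge (k%:Z * M) (f ^+ k).
Proof.
move=> of_; elim: k => [|k IH]; first by rewrite mul0r expr0; exact: ord_ge_puiseuxC.
by rewrite exprS -add1n PoszD mulrDl mul1r; apply: ord_geM.
Qed.

Lemma ord_ge_pderiv {N f} : ord_ge N f -> ord_ge (N - b%:Z) (pderiv f).
Proof.
move=> of_ r; rewrite mulf_eq0 negb_or => /andP[_ /of_ [k Nk rk]].
exists (k - b%:Z); first by rewrite lerB.
by rewrite intrB mulrBl -rk divff ?addrK // pnatr_eq0 -lt0n.
Qed.

Lemma ord_ge_zpow1 : ord_ge b (zpow K 1).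
Proof.
have -> : 1 = b%:Z%:~R / b%:R :> rat by rewrite divff // pnatr_eq0 -lt0n.
exact: ord_ge_zpow.
Qed.

Lemma ord_ge_lead {N f} :
  ord_ge N f ->
  ord_ge (N + 1) (f - puiseuxC (pcoef f (N%:~R / b%:R)) * zpow K (N%:~R / b%:R)).
Proof.
move=> of_ r; rewrite pcoefD pcoefN pcoef_puiseuxC_mul pcoef_zpow.
have [->|nr] := eqVneq r (N%:~R / b%:R); first by rewrite mulr1 subrr eqxx.
rewrite mulr0 subr0 => /of_ [k Nk rk]; exists k => //.
rewrite -ltzD1 ltrD2r lt_neqAle Nk andbT.
by apply: contraNneq nr => ->; rewrite rk.
Qed.

Lemma ord_ge_all N {f} : (forall k : nat, ord_ge (N + k%:Z) f) -> f = 0.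
Proof.
move=> of_; apply: puiseux_ext => r; rewrite /= /delta if_same.
apply/eqP/negPn/negP => fr; have [k Nk rk] := of_ 0%N _ fr.
have [l Nl rl] := of_ `|(k - N + 1)%R|%N _ fr.
have bV0 : b%:R^-1 != 0 :> rat by rewrite invr_eq0 pnatr_eq0 -lt0n.
move: Nl; rewrite rk in rl; move/(mulIf bV0)/intr_inj: rl => ->; lia.
Qed.

Lemma ord_ge1_puiseuxC {c : K} : ord_ge 1 (puiseuxC c) -> c = 0.
Proof.
move=> oc; apply/eqP/negPn/negP => c0.
have [|k k1 /esym/eqP] := oc 0; first by rewrite /= /delta eqxx.
by rewrite mulf_eq0 invr_eq0 !pnatr_eq0 intr_eq0 (gtn_eqF b_gt0) orbF; lia.
Qed.

(** Completeness of K((z^(1/b))) for the order. The limit takes its coefficient at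
    z^(k/b) from S_k, since the later terms no longer change it. *)
Lemma ord_ge_complete {S : nat -> puiseux K} :
  (forall k : nat, ord_ge k.+1 (S k.+1 - S k)) ->
  exists Y, forall k : nat, ord_ge k.+1 (Y - S k).
Proof.
move=> oS.
have oSd j k : (k <= j)%N -> ord_ge k.+1 (S j - S k).
  elim: j => [|j IH]; first by rewrite leqn0 => /eqP->; rewrite subrr; exact: ord_ge0.
  rewrite leq_eqVlt => /orP[/eqP->|]; first by rewrite subrr; exact: ord_ge0.
  rewrite ltnS => kj; rewrite -(subrK (S j) (S j.+1)) -addrA; apply: ord_geD _ (IH kj).
  by apply: ord_ge_le (oS j).
(* the absolute value only matters off the support, where any index will do *)
pose idx (r : rat) := `|Num.floor (r * b%:R)|%N.
have idxE (k : int) : idx (k%:~R / b%:R) = `|k|%N.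
  by rewrite /idx divfK ?intrKfloor // pnatr_eq0 -lt0n.
pose D (r : rat) := pcoef (S (idx r) - S 0%N) r.
have sD : supp_ge b 0 D.
  by move=> r /(oSd _ _ (leq0n _)) [k k0 rk]; exists k => //; lia.
have pD : is_puiseux D by exists b, 0.
exists (S 0%N + Puiseux pD) => k r.
have -> : pcoef (S 0%N + Puiseux pD - S k) r = pcoef (S (idx r) - S k) r.
  by rewrite !(pcoefD, pcoefN) /= /D !(pcoefD, pcoefN); ring.
have [kr|rk] := leqP k (idx r); first exact: oSd.
rewrite -[S _ - _]opprB pcoefN oppr_eq0 => /(oSd _ _ (ltnW rk)) [j jr rj].
move: jr; rewrite rj idxE; lia.
Qed.

(** A relation and not a function: it carries with it that f has order >= 0, without
    which the constant coefficient is not multiplicative. *)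
Definition has_residue (c : K) f := ord_ge 1 (f - puiseuxC c).

Lemma has_residue_ord_ge0 {c f} : has_residue c f -> ord_ge 0 f.
Proof.
move=> fc; rewrite -(subrK (puiseuxC c) f); apply: ord_geD _ (ord_ge_puiseuxC c).
exact: ord_ge_le fc.
Qed.

Lemma has_residueC c : has_residue c (puiseuxC c).
Proof. by rewrite /has_residue subrr; exact: ord_ge0. Qed.

Lemma has_residueD {c d f g} :
  has_residue c f -> has_residue d g -> has_residue (c + d) (f + g).
Proof.
by move=> fc gd; rewrite /has_residue rmorphD opprD addrACA; apply: ord_geD.
Qed.

Lemma has_residueM {c d f g} :
  has_residue c f -> has_residue d g -> has_residue (c * d) (f * g).
Proof.
move=> fc gd; rewrite /has_residue rmorphM.
have -> : f * g - puiseuxC c * puiseuxC d =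
  (f - puiseuxC c) * g + puiseuxC c * (g - puiseuxC d) by ring.
apply: ord_geD; last exact: ord_geCM.
by rewrite -[1]addr0; apply: ord_geM _ (has_residue_ord_ge0 gd).
Qed.

Lemma has_residue_det {k} {A : 'M[K]_k} {W : 'M[puiseux K]_k} :
  (forall i j, has_residue (A i j) (W i j)) -> has_residue (\det A) (\det W).
Proof.
move=> AW; apply: (big_rec2 has_residue) => [|s x y _ xy].
  by rewrite -(rmorph0 (@puiseuxC K)); exact: has_residueC.
apply: has_residueD _ xy; apply: has_residueM.
  by rewrite -(rmorph_sign (@puiseuxC K)); exact: has_residueC.
apply: (big_rec2 has_residue) => [|i x' y' _ xy']; first exact: has_residueC.
exact: has_residueM.
Qed.

(** If T is chi z^(e/b) (z d/dz) up to terms of higher order, then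
    T (z^(k/b)) = (chi k / b) z^((k + e)/b) + ...; for k > 0 this can cancel the lowest
    term left by the previous partial sum, and for k = 0 there is nothing to cancel. *)
Lemma euler_kernel {T : puiseux K -> puiseux K} {chi : K} {e : int} :
  zmod_morphism T -> chi != 0 ->
  (forall N f, ord_ge N f -> ord_ge (N + e + 1)
     (T f - puiseuxC chi * zpow K (e%:~R / b%:R) * (zpow K 1 * pderiv f))) ->
  exists2 y, has_residue 1 y & T y = 0.
Proof.
move=> TB chi0 TE.
have oT N f : ord_ge N f -> ord_ge (N + e) (T f).
  move=> of_; set E := puiseuxC chi * zpow K (e%:~R / b%:R) * (zpow K 1 * pderiv f).
  rewrite -(subrK E (T f)).
  apply: ord_geD; first by apply: ord_ge_le (TE _ _ of_); lia.
  rewrite addrC; apply: ord_geM; first by apply: ord_geCM; exact: ord_ge_zpow.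
  rewrite -[N](subrKC b%:Z); apply: ord_geM; first exact: ord_ge_zpow1.
  exact: ord_ge_pderiv.
pose ex (k : int) : rat := k%:~R / b%:R.
have bn0 : b%:R != 0 :> rat by rewrite pnatr_eq0 -lt0n.
have bK0 : b%:R != 0 :> K by rewrite pnatr_eq0 -lt0n.
pose step (k : nat) f := f - puiseuxC
  (pcoef (T f) (ex (k.+1%:Z + e)) / (chi * (k.+1%:R / b%:R))) * zpow K (ex k.+1).
pose fix S (k : nat) : puiseux K := if k is k'.+1 then step k' (S k') else 1.
have TS k : ord_ge (k.+1%:Z + e) (T (S k)).
  elim: k => [|k IH].
    have := TE 0 _ (ord_ge_puiseuxC 1).
    by rewrite pderiv_puiseuxC !mulr0 subr0 add0r addrC.
  have -> : k.+2%:Z + e = k.+1%:Z + e + 1 by lia.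
  rewrite /= /step TB.
  set d := pcoef _ _ / _; have := TE k.+1 _ (ord_geCM d (ord_ge_zpow k.+1)).
  rewrite pderivM pderiv_puiseuxC mul0r add0r pderiv_zpow.
  set X := T (_ * zpow K _); set Y := puiseuxC chi * _ * _ => oX.
  have -> : T (S k) - X = (T (S k) - Y) - (X - Y) by ring.
  apply: ord_geB _ oX; have -> : Y = puiseuxC (pcoef (T (S k)) (ex (k.+1%:Z + e))) *
      zpow K (ex (k.+1%:Z + e)); last exact: ord_ge_lead.
  have -> : pcoef (T (S k)) (ex (k.+1%:Z + e)) = chi * d * ratr (k.+1%:~R / b%:R).
    rewrite /d rmorphM fmorphV !rmorph_nat; field.
    by rewrite bK0 chi0 nat1r pnatr_eq0.
  have -> : ex (k.+1%:Z + e) = e%:~R / b%:R + (1 + (ex k.+1 - 1)).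
    by rewrite /ex intrD mulrDl; ring.
  rewrite zpowD (zpowD _ 1) {}/Y /ex.
  move: (ratr _) => c; rewrite (rmorphM _ (chi * d)) (rmorphM _ chi d) /=.
  clearbody d.
  move: (zpow K _) (zpow K 1) (zpow K _) => u v w. ring.
have [|Y SY] := @ord_ge_complete S.
  move=> k; rewrite /= /step addrAC subrr add0r; apply: ord_geN.
  by apply: ord_geCM; exact: ord_ge_zpow.
exists Y; first exact: SY 0%N.
apply: (ord_ge_all e) => k; rewrite -(subrK (T (S k)) (T Y)) -TB.
apply: ord_geD; first by apply: ord_ge_le (oT _ _ (SY k)); lia.
by apply: ord_ge_le (TS k); lia.
Qed.

End OrderFiltration.

(** * The derivation z^2 d/dz twisted by an exponent *)

Section Twist.
Context {K : numFieldType}.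
Implicit Types (f g h : puiseux K).

Definition z2deriv f := zpow K 2 * pderiv f.

(** The conjugate of z^2 d/dz by exp (int g / z^2): if E' = (g / z^2) E, then
    z^2 (E f)' = E (twist g f). *)
Definition twist g f := z2deriv f + g * f.

Lemma z2derivD f h : z2deriv (f + h) = z2deriv f + z2deriv h.
Proof. by rewrite /z2deriv pderivD mulrDr. Qed.

Lemma z2derivB f h : z2deriv (f - h) = z2deriv f - z2deriv h.
Proof. by rewrite /z2deriv pderivB mulrBr. Qed.

Lemma z2derivM f h : z2deriv (f * h) = z2deriv f * h + f * z2deriv h.
Proof. by rewrite /z2deriv pderivM; ring. Qed.

Lemma z2deriv_nat k : z2deriv k%:R = 0.
Proof. by rewrite /z2deriv -(rmorph_nat (@puiseuxC K)) pderiv_puiseuxC mulr0. Qed.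

Lemma z2derivX f k : z2deriv (f ^+ k) = k%:R * f ^+ k.-1 * z2deriv f.
Proof.
elim: k => [|k IH]; first by rewrite expr0 (z2deriv_nat 1) !mul0r.
rewrite exprS z2derivM IH -natr1 /=; case: k {IH} => [|k] /=.
  by rewrite expr0; ring.
by rewrite exprS; ring.
Qed.

Lemma twistB g : zmod_morphism (twist g).
Proof. by move=> f h; rewrite /twist z2derivB mulrBr; ring. Qed.

Lemma iter_twistB g k : zmod_morphism (iter k (twist g)).
Proof. by elim: k => // k IH f h; rewrite !iterS IH twistB. Qed.

Section Order.
Context {b : nat} (b_gt0 : (0 < b)%N).
Implicit Types (M N L : int).
Local Notation ord_ge := (@ord_ge K b).

Lemma ord_ge_z2deriv {N f} : ord_ge N f -> ord_ge (N + b%:Z) (z2deriv f).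
Proof.
move=> of_; have -> : N + b%:Z = (b%:Z + b%:Z) + (N - b%:Z) by lia.
apply: ord_geM; last exact: ord_ge_pderiv.
by rewrite -[2]/(1 + 1) zpowD; apply: ord_geM; apply: ord_ge_zpow1.
Qed.

(** Stated with k - 1 in int, so that k = 0 is covered (the difference is then 0). *)
Lemma ord_geXB {L M f g} k : ord_ge M f -> ord_ge M g -> ord_ge L (f - g) ->
  ord_ge (L + (k%:Z - 1) * M) (f ^+ k - g ^+ k).
Proof.
move=> of_ og ofg; case: k => [|k]; first by rewrite subrr; exact: ord_ge0.
rewrite subrXX; apply: (ord_geM ofg); apply: ord_ge_sum => i _.
have -> : (k.+1%:Z - 1) * M = (k.+1.-1 - i)%N%:Z * M + i%:Z * M.
  by rewrite -mulrDl; congr (_ * _); have := ltn_ord i; lia.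
by apply: ord_geM; apply: ord_geX.
Qed.

Lemma ord_ge_exprD2 {M f h} k : M <= 0 -> ord_ge M f -> ord_ge 0 h ->
  ord_ge ((k%:Z - 1) * M) ((f + h) ^+ k.+1 - f ^+ k.+1 - k.+1%:R * f ^+ k * h).
Proof.
move=> M0 of_ oh; elim: k => [|k IH].
  have -> : (f + h) ^+ 1 - f ^+ 1 - 1%:R * f ^+ 0 * h = 0 by ring.
  exact: ord_ge0.
have -> : (f + h) ^+ k.+2 - f ^+ k.+2 - k.+2%:R * f ^+ k.+1 * h =
  (f + h) * ((f + h) ^+ k.+1 - f ^+ k.+1 - k.+1%:R * f ^+ k * h) +
  k.+1%:R * (f ^+ k * (h * h)).
  by rewrite !exprS -!natr1; ring.
apply: ord_geD.
  have -> : (k.+1%:Z - 1) * M = M + (k%:Z - 1) * M by lia.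
  by apply: ord_geM _ IH; apply: ord_geD => //; apply: ord_ge_le oh.
have -> : (k.+1%:Z - 1) * M = k%:Z * M + (0 + 0) by lia.
by apply: ord_ge_natM; apply: ord_geM; [exact: ord_geX|exact: ord_geM].
Qed.

Lemma ord_ge_twist {m : nat} {N g f} :
  ord_ge (- m%:Z) g -> ord_ge N f -> ord_ge (N - m%:Z) (twist g f).
Proof.
move=> og of_; apply: ord_geD; last by rewrite addrC; apply: ord_geM.
by apply: ord_ge_le (ord_ge_z2deriv of_); lia.
Qed.

Lemma ord_ge_iter_twist {m : nat} {N g f} k :
  ord_ge (- m%:Z) g -> ord_ge N f -> ord_ge (N - k%:Z * m%:Z) (iter k (twist g) f).
Proof.
move=> og of_; elim: k => [|k IH]; first by rewrite mul0r subr0.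
have -> : N - k.+1%:Z * m%:Z = N - k%:Z * m%:Z - m%:Z by lia.
by rewrite iterS; apply: ord_ge_twist.
Qed.

(** In the expansion of (delta + g)^k f each delta takes the place of a factor g, which
    raises the order by b + m; the terms written out are those with at most one delta. *)
Lemma iter_twist_expansion {m : nat} {N g f} k :
  ord_ge (- m%:Z) g -> ord_ge N f ->
  ord_ge (N - k%:Z * m%:Z + 2 * (b%:Z + m%:Z))
    (iter k (twist g) f -
     (g ^+ k * f + k%:R * g ^+ k.-1 * z2deriv f
      + 'C(k, 2)%:R * g ^+ k.-2 * z2deriv g * f)).
Proof.
move=> og of_; elim: k => [|k IH].
  rewrite bin0n /= !mul0r expr0 mul1r !addr0 subrr; exact: ord_ge0.
set main := (X in iter k _ f - X) in IH.
set A := k%:R * g ^+ k.-1; set B := 'C(k, 2)%:R * g ^+ k.-2.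
(* k.-1 and k.-2 are truncated only when the coefficient in front vanishes *)
have AE : g * A = k%:R * g ^+ k.
  by rewrite /A; case: k {IH main A B} => [|k]; rewrite ?exprS; ring.
have BE : g * B = 'C(k, 2)%:R * g ^+ k.-1.
  rewrite /B; case: k {IH main A B AE} => [|[|k]]; first by rewrite bin0n !mul0r mulr0.
    by rewrite bin_small // !mul0r mulr0.
  by rewrite mulrCA -exprS.
have oA : ord_ge (m%:Z - k%:Z * m%:Z) A.
  rewrite /A; case: k {IH main A B AE BE} => [|k]; first by rewrite !mul0r; exact: ord_ge0.
  by apply: ord_ge_natM; apply: ord_ge_le (ord_geX k og); lia.
have oB : ord_ge (2 * m%:Z - k%:Z * m%:Z) B.
  rewrite /B; case: k {IH main A B AE BE oA} => [|[|k]].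
  - by rewrite bin_small // !mul0r; exact: ord_ge0.
  - by rewrite bin_small // !mul0r; exact: ord_ge0.
  by apply: ord_ge_natM; apply: ord_ge_le (ord_geX k og); lia.
have oDf := ord_ge_z2deriv of_.
have oDg := ord_ge_z2deriv og.
have -> : iter k.+1 (twist g) f - (g ^+ k.+1 * f + k.+1%:R * g ^+ k * z2deriv f
      + 'C(k.+1, 2)%:R * g ^+ k.-1 * z2deriv g * f) =
  twist g (iter k (twist g) f - main) +
  (z2deriv (A * z2deriv f) + z2deriv (B * z2deriv g * f)).
  rewrite iterS twistB; move: (twist g (iter k _ f)) => v.
  rewrite /twist /main -/A -/B !z2derivD !mulrDr !z2derivM z2derivX -/A.
  rewrite binS bin1 natrD -natr1 exprS.
  have -> : g * (A * z2deriv f) = k%:R * g ^+ k * z2deriv f by rewrite -AE; ring.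
  have -> : g * (B * z2deriv g * f) = 'C(k, 2)%:R * g ^+ k.-1 * z2deriv g * f.
    by rewrite -BE; ring.
  by rewrite /A; ring.
apply: ord_geD.
  by apply: ord_ge_le (ord_ge_twist og IH); lia.
apply: ord_geD.
  by apply: ord_ge_le (ord_ge_z2deriv (ord_geM oA oDf)); lia.
apply: ord_ge_le (ord_ge_z2deriv (ord_geM (ord_geM oB oDg) of_)).
lia.
Qed.

End Order.
End Twist.

(** * The scalar Airy operator near z = 0 *)

Section AiryOperator.
Context {K : numFieldType}.
Implicit Types (f g h lam : puiseux K) (P Q : {poly K}).

Definition at_inf Q := (map_poly (@puiseuxC K) Q).[zpow K (- 1)].

(** The last row of the companion system for twist g: zero on y means that
    (y, twist g y, ..., twist g^(n-1) y) solves the whole system. *)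
Definition airy_op n P Q g f :=
  iter n (twist g) f
  - \sum_(1 <= j < n) puiseuxC P`_j * iter j (twist g) f - at_inf Q * f.

Lemma airy_opB n P Q g : zmod_morphism (airy_op n P Q g).
Proof.
move=> f h; rewrite /airy_op iter_twistB mulrBr.
under eq_bigr => j _ do rewrite iter_twistB mulrBr.
by rewrite sumrB; ring.
Qed.

Lemma z2deriv_zpow r : z2deriv (zpow K r) = puiseuxC (ratr r) * zpow K 1 * zpow K r.
Proof.
rewrite /z2deriv pderiv_zpow mulrCA -mulrA -!zpowD; congr (_ * zpow K _); ring.
Qed.

Lemma z2derivC (c : K) : z2deriv (puiseuxC c) = 0.
Proof. by rewrite /z2deriv pderiv_puiseuxC mulr0. Qed.

Section Expansion.
Variables (k m : nat).
Local Notation n := k.+2.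
Let n_gt0 : (0 < n)%N := isT.
Hypothesis lt_nm : (n < m)%N.
Variables (P Q : {poly K}) (c : K) (lam : puiseux K).
Local Notation ord_ge := (@ord_ge K n).
Local Notation ell := (puiseuxC c * zpow K ((- m%:Z)%:~R / n%:R)).
Let kappa : K := (n%:R - 1) * m%:R / (2 * n%:R).
Hypothesis lam_lead : ord_ge (1 - m%:Z) (lam - ell).
Hypothesis lam_root :
  ord_ge (n%:Z + 1 - (n%:Z - 1) * m%:Z) (lam ^+ n - at_inf Q).
(** Besides lam: a_(n-1) / n completes the n-th power, and kappa z is the logarithmic
    derivative, for z^2 d/dz, of the WKB amplitude lam^(-(n-1)/2), to leading order. *)
Definition airy_exponent := lam + puiseuxC (P`_k.+1 / n%:R)
   + puiseuxC kappa * zpow K 1.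

Lemma ord_ge_ell : ord_ge (- m%:Z) ell.
Proof. by apply: ord_geCM; exact: ord_ge_zpow. Qed.

Lemma ord_ge_airy_exponent : ord_ge (1 - m%:Z) (airy_exponent - ell).
Proof.
rewrite /airy_exponent -[lam + _ + _]addrA addrAC; apply: ord_geD => //.
apply: ord_geD.
  by apply: ord_ge_le (ord_ge_puiseuxC _); lia.
by apply: ord_geCM; apply: ord_ge_le (ord_ge_zpow1 n_gt0); lia.
Qed.

Lemma ord_ge_of_lead {f} : ord_ge (1 - m%:Z) (f - ell) -> ord_ge (- m%:Z) f.
Proof.
by move=> of_; rewrite -(subrK ell f); apply: ord_geD _ ord_ge_ell; apply: ord_ge_le of_; lia.
Qed.

(** With h = g - lam of order 0, g^n - a_(n-1) g^(n-1) is
    lam^n + (n h - a_(n-1)) lam^(n-1) up to h^2 lam^(n-2), which is negligible because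
    n < m. What remains, n kappa z lam^(n-1), cancels 'C(n, 2) g^(n-2) delta g, as
    delta multiplies z^(-m/n) by - (m / n) z. *)
Lemma airy_exponent_root : let g := airy_exponent in
  ord_ge (n%:Z + 1 - (n%:Z - 1) * m%:Z)
    (g ^+ n + 'C(n, 2)%:R * g ^+ k * z2deriv g
     - puiseuxC P`_k.+1 * g ^+ k.+1 - at_inf Q).
Proof.
move=> g; set l := ell; set a := P`_k.+1.
pose h := puiseuxC (a / n%:R) + puiseuxC kappa * zpow K 1.
have nK0 : n%:R != 0 :> K by rewrite pnatr_eq0.
have oz : ord_ge n (zpow K 1) by exact: ord_ge_zpow1.
have oh : ord_ge 0 h.
  apply: ord_geD; first exact: ord_ge_puiseuxC.
  by apply: ord_geCM; apply: ord_ge_le oz.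
have ol : ord_ge (- m%:Z) l := ord_ge_ell.
have olam := ord_ge_of_lead lam_lead.
have ogl : ord_ge (1 - m%:Z) (g - l) := ord_ge_airy_exponent.
have og := ord_ge_of_lead ogl.
have gE : g = lam + h by rewrite /g /airy_exponent -addrA.
clearbody g.
have oDgl : ord_ge (1 - m%:Z + n%:Z) (z2deriv g - z2deriv l).
  by rewrite -z2derivB; exact: (ord_ge_z2deriv n_gt0).
have oDg := ord_ge_z2deriv n_gt0 og.
have Dl : z2deriv l = - puiseuxC (m%:R / n%:R) * zpow K 1 * l.
  rewrite /l z2derivM z2derivC mul0r add0r z2deriv_zpow.
  have -> : ratr ((- m%:Z)%:~R / n%:R) = - (m%:R / n%:R) :> K.
    by rewrite intrN mulNr rmorphN /= fmorph_div /= !rmorph_nat.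
  by rewrite rmorphN /=; ring.
have nh : n%:R * h = puiseuxC a + puiseuxC (n%:R * kappa) * zpow K 1.
  rewrite /h mulrDr mulrA -!(rmorph_nat (@puiseuxC K)) -!rmorphM /=.
  by rewrite mulrCA divff // mulr1.
have kappaE : puiseuxC (n%:R * kappa) = 'C(n, 2)%:R * puiseuxC (m%:R / n%:R).
  rewrite -(rmorph_nat (@puiseuxC K)) -rmorphM; congr puiseuxC.
  have -> : 'C(n, 2)%:R = n%:R * (n%:R - 1) / 2 :> K.
    apply: (@mulIf _ 2); first by rewrite pnatr_eq0.
    rewrite divfK ?pnatr_eq0 // mulrC -natrM mul_bin_left bin1 mulnC natrM.
    by rewrite -natr1 addrK subn1.
  by rewrite /kappa; move: (n%:R : K) nK0 => x x0; field.
have -> : g ^+ n + 'C(n, 2)%:R * g ^+ k * z2deriv g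
     - puiseuxC a * g ^+ k.+1 - at_inf Q =
  (lam ^+ n - at_inf Q)
  + (g ^+ n - lam ^+ n - n%:R * lam ^+ k.+1 * h)
  - puiseuxC a * (g ^+ k.+1 - lam ^+ k.+1)
  + 'C(n, 2)%:R * (g ^+ k * (z2deriv g - z2deriv l) + (g ^+ k - l ^+ k) * z2deriv l)
  + puiseuxC (n%:R * kappa) * (zpow K 1 * (lam ^+ k.+1 - l ^+ k.+1)).
  have -> : n%:R * lam ^+ k.+1 * h =
      (puiseuxC a + puiseuxC (n%:R * kappa) * zpow K 1) * lam ^+ k.+1.
    by rewrite -nh mulrAC.
  by rewrite Dl kappaE [l ^+ k.+1]exprS; ring.
apply: ord_geD; last first.
  apply: ord_geCM; have := ord_geM oz (ord_geXB n_gt0 k.+1 olam ol lam_lead).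
  by apply: ord_ge_le; lia.
apply: ord_geD; last first.
  apply: ord_ge_natM; apply: ord_geD.
    by apply: ord_ge_le (ord_geM (ord_geX k og) oDgl); lia.
  apply: ord_ge_le (ord_geM (ord_geXB n_gt0 k og ol ogl) (ord_ge_z2deriv n_gt0 ol)).
  by lia.
apply: ord_geB; last first.
  apply: ord_geCM; have ogh : ord_ge 0 (g - lam) by rewrite gE addrAC subrr add0r.
  by apply: ord_ge_le (ord_geXB n_gt0 k.+1 og olam ogh); lia.
apply: ord_geD => //; rewrite gE.
have M0 : - m%:Z <= 0 by lia.
by apply: ord_ge_le (ord_ge_exprD2 n_gt0 k.+1 M0 olam oh); lia.
Qed.

(** Only n g^(n-1) delta f matters among the terms with derivatives of f: the others
    carry at most g^(n-2), whose order is larger by m. *)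
Lemma airy_op_expansion {N : int} {f} :
  ord_ge N f ->
  ord_ge (N + (n%:Z - (n%:Z - 1) * m%:Z) + 1)
    (airy_op n P Q airy_exponent f
     - puiseuxC (n%:R * c ^+ k.+1) * zpow K ((n%:Z - (n%:Z - 1) * m%:Z)%:~R / n%:R)
       * (zpow K 1 * pderiv f)).
Proof.
set g := airy_exponent; set l := ell => of_.
have ol : ord_ge (- m%:Z) l := ord_ge_ell.
have ogl : ord_ge (1 - m%:Z) (g - l) := ord_ge_airy_exponent.
have og := ord_ge_of_lead ogl.
have oZ := airy_exponent_root; rewrite /= -/g in oZ.
have oDf := ord_ge_z2deriv n_gt0 of_.
have En := iter_twist_expansion n_gt0 n og of_.
have Ep := iter_twist_expansion n_gt0 k.+1 og of_.
rewrite /airy_op; clearbody g; rewrite big_nat_recr //=.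
set low := \sum_(_ <= _ < _) _; set a := P`_k.+1.
have olow : ord_ge (N + (n%:Z - (n%:Z - 1) * m%:Z) + 1) low.
  rewrite /low big_nat_cond; apply: ord_ge_sum => j; rewrite andbT => /andP[j0 jk].
  apply: ord_geCM; apply: ord_ge_le (ord_ge_iter_twist n_gt0 j og of_).
  by nia.
have -> : puiseuxC (n%:R * c ^+ k.+1)
    * zpow K ((n%:Z - (n%:Z - 1) * m%:Z)%:~R / n%:R) * (zpow K 1 * pderiv f) =
    n%:R * l ^+ k.+1 * z2deriv f.
  have nQ0 : n%:R != 0 :> rat by rewrite pnatr_eq0.
  have -> : (n%:Z - (n%:Z - 1) * m%:Z)%:~R / n%:R =
      1 + k.+1%:R * ((- m%:Z)%:~R / n%:R) :> rat.
    rewrite intrB intrM intrB intrN -[n%:~R](natrD _ 1 k.+1) natrD.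
    by field; rewrite nat1r.
  rewrite /l /z2deriv exprMn zpowX rmorphM rmorphXn rmorph_nat zpowD.
  by rewrite -[2]/(1 + 1 : rat) zpowD; ring.
have -> : iter n (twist g) f - (low + puiseuxC a * iter k.+1 (twist g) f)
    - at_inf Q * f - n%:R * l ^+ k.+1 * z2deriv f =
  (iter n (twist g) f - (g ^+ n * f + n%:R * g ^+ k.+1 * z2deriv f
      + 'C(n, 2)%:R * g ^+ k * z2deriv g * f))
  - low
  - puiseuxC a * (iter k.+1 (twist g) f - (g ^+ k.+1 * f
      + k.+1%:R * g ^+ k * z2deriv f + 'C(k.+1, 2)%:R * g ^+ k.-1 * z2deriv g * f))
  - puiseuxC a * (k.+1%:R * (g ^+ k * z2deriv f)
      + 'C(k.+1, 2)%:R * (g ^+ k.-1 * (z2deriv g * f)))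
  + (g ^+ n + 'C(n, 2)%:R * g ^+ k * z2deriv g - puiseuxC a * g ^+ k.+1 - at_inf Q) * f
  + n%:R * ((g ^+ k.+1 - l ^+ k.+1) * z2deriv f).
  by ring.
have oDg := ord_ge_z2deriv n_gt0 og.
apply: ord_geD; last first.
  apply: ord_ge_natM; have := ord_geM (ord_geXB n_gt0 k.+1 og ol ogl) oDf.
  by apply: ord_ge_le; nia.
apply: ord_geD; last by apply: ord_ge_le (ord_geM oZ of_); lia.
apply: ord_geB; last first.
  apply: ord_geCM; apply: ord_geD.
    by apply: ord_ge_natM; apply: ord_ge_le (ord_geM (ord_geX k og) oDf); nia.
  (* for k = 0 the exponent k.-1 is truncated, and the binomial vanishes *)
  have [k0|k0] := posnP k.
    by rewrite [in 'C(_, _)]k0 bin_small // mul0r; exact: ord_ge0.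
  apply: ord_ge_natM.
  by apply: ord_ge_le (ord_geM (ord_geX k.-1 og) (ord_geM oDg of_)); nia.
apply: ord_geB; last by apply: ord_geCM; apply: ord_ge_le Ep; nia.
by apply: ord_geB => //; apply: ord_ge_le En; nia.
Qed.

End Expansion.
End AiryOperator.

(** * Diagonalising the companion matrix *)

Section Diagonalisation.
Context {K : numFieldType}.
Implicit Types (f g h lam : puiseux K) (P Q : {poly K}).

Lemma pderiv_sum (I : Type) (s : seq I) (F : I -> puiseux K) :
  pderiv (\sum_(i <- s) F i) = \sum_(i <- s) pderiv (F i).
Proof. by apply: (big_morph _ (@pderivD K)); exact: pderiv0. Qed.

Lemma map_pderiv_mul n (X Y : 'M[puiseux K]_n) :
  map_mx (@pderiv K) (X *m Y) =
    map_mx (@pderiv K) X *m Y + X *m map_mx (@pderiv K) Y.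
Proof.
apply/matrixP => i j; rewrite !mxE pderiv_sum -big_split.
by apply: eq_bigr => k _; rewrite !mxE pderivM.
Qed.

(** Differentiating V^-1 V = 1 gives (V^-1)' V = - V^-1 V', so the equation for V
    is that of the gauge transformation by V^-1. *)
Lemma gauge_invmx n (A D V : 'M[puiseux K]_n) :
  V \in unitmx -> A *m V = map_mx (@pderiv K) V + V *m D ->
  gauge (invmx V) A = D.
Proof.
move=> uV AV; rewrite /gauge invmxK -mulmxA AV.
have : map_mx (@pderiv K) (invmx V *m V) = 0.
  rewrite mulVmx //; apply/matrixP => i j; rewrite !mxE.
  by rewrite -(rmorph_nat (@puiseuxC K)) pderiv_puiseuxC.
rewrite map_pderiv_mul => /eqP; rewrite addrC addr_eq0 => /eqP VE.
by rewrite mulmxDr VE mulKmx // addrAC addNr add0r.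
Qed.

Lemma twistE g f : zpow K (- 2) * twist g f = pderiv f + zpow K (- 2) * g * f.
Proof. by rewrite /twist /z2deriv mulrDr !mulrA -zpowD addNr zpow0 mul1r. Qed.

Lemma airy_mx_companion n P Q g y :
  (1 < n)%N -> airy_op n P Q g y = 0 -> forall i : 'I_n,
  \sum_j airy_mx n P Q i j * iter j (twist g) y =
    pderiv (iter i (twist g) y) + zpow K (- 2) * g * iter i (twist g) y.
Proof.
move=> n1 Ty i; rewrite -twistE -iterS.
case: n n1 Ty i => // -[|k] // _ Ty i.
have [il|il] := eqVneq i.+1 k.+2.
  under eq_bigr => j _ do rewrite mxE il eqxx -mulrA.
  rewrite -mulr_sumr il; congr (_ * _).
  move/eqP: Ty; rewrite /airy_op subr_eq0 subr_eq => /eqP ->.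
  rewrite big_ord_recl /=; congr (_ + _).
  by rewrite big_add1 big_mkord; apply: eq_bigr.
have ik : (i.+1 < k.+2)%N by rewrite ltn_neqAle il ltn_ord.
rewrite (bigD1 (Ordinal ik)) //= mxE (negPf il) eqxx big1 ?addr0 // => j ji.
rewrite mxE (negPf il) ifF ?mul0r //; apply: contraNF ji => /eqP ji.
by apply/eqP/val_inj.
Qed.

(** Each twist multiplies the leading coefficient by that of g, since the derivative
    part has higher order. *)
Lemma has_residue_iter_twist b m c g y k : (0 < b)%N ->
  ord_ge (b := b) (1 - m%:Z) (g - puiseuxC c * zpow K ((- m%:Z)%:~R / b%:R)) ->
  has_residue (b := b) 1 y ->
  has_residue (b := b) (c ^+ k) (zpow K (k%:R * (m%:R / b%:R)) * iter k (twist g) y).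
Proof.
move=> b0 og oy; elim: k => [|k IH].
  by rewrite mul0r zpow0 mul1r.
set t := zpow K (m%:R / b%:R).
have ot : ord_ge (b := b) m t by apply: ord_ge_zpow.
have gc : has_residue (b := b) c (t * g).
  have -> : c = c + 0 by rewrite addr0.
  set e := puiseuxC c * _ in og; have -> : t * g = t * e + t * (g - e) by ring.
  apply: has_residueD.
    rewrite /e /t mulrCA -zpowD intrN mulNr addrN zpow0 mulr1; exact: has_residueC.
  rewrite /has_residue rmorph0 subr0.
  by have := ord_geM ot og; apply: ord_ge_le; lia.
have -> : zpow K (k.+1%:R * (m%:R / b%:R)) = t * zpow K (k%:R * (m%:R / b%:R)).
  by rewrite -zpowD -nat1r mulrDl mul1r.
set u := zpow K (k%:R * _) in IH *; set w := iter k _ y in IH *.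
have ou : ord_ge (b := b) (k%:Z * m%:Z) u.
  by rewrite /u mulrA -natrM; exact: (ord_ge_zpow (k * m)%N).
have ow : ord_ge (b := b) (- (k%:Z * m%:Z)) w.
  have -> : w = zpow K ((- (k%:Z * m%:Z))%:~R / b%:R) * (u * w).
    rewrite mulrA -zpowD intrN mulNr intrM -mulrA addNr zpow0 mul1r //.
  by rewrite -[X in ord_ge X _]addr0; apply: ord_geM _ (has_residue_ord_ge0 IH);
    exact: ord_ge_zpow.
have -> : t * u * iter k.+1 (twist g) y = (t * g) * (u * w) + t * (u * z2deriv w).
  by rewrite iterS /twist -/w; ring.
have -> : c ^+ k.+1 = c * c ^+ k + 0 by rewrite exprS addr0.
apply: has_residueD; first exact: has_residueM.
rewrite /has_residue rmorph0 subr0.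
apply: ord_ge_le (ord_geM ot (ord_geM ou (ord_ge_z2deriv b0 ow))); lia.
Qed.

(** The determinant has the Vandermonde determinant of the c_j as its residue. *)
Lemma unitmx_of_residues b n (W : 'M[puiseux K]_n) (c : 'I_n -> K) :
  (0 < b)%N -> injective c ->
  (forall i j : 'I_n, has_residue (b := b) (c j ^+ i) (W i j)) -> W \in unitmx.
Proof.
move=> b0 c_inj Wc; pose a : 'rV[K]_n := \row_j c j.
have : has_residue (b := b) (\det (Vandermonde n a)) (\det W).
  by apply: has_residue_det => i j; rewrite !mxE.
rewrite unitmxE unitfE; apply: contraPneq => ->.
rewrite /has_residue sub0r => /ord_geN; rewrite opprK => /(ord_ge1_puiseuxC b0) /eqP.
apply/negP; rewrite det_Vandermonde; apply/prodf_neq0 => i _; apply/prodf_neq0 => j ij.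
rewrite !mxE subr_eq0; apply: contraTneq ij => /c_inj ->; by rewrite ltnn.
Qed.

End Diagonalisation.

(** * Roots of the leading polynomial, and the theorem *)

Section Roots.

Lemma coef_last_neq0 {R : nzRingType} {p : {poly R}} {m} :
  size p = m.+1 -> p`_m != 0.
Proof.
move=> sp; have := lead_coef_eq0 p; rewrite lead_coefE sp /= => ->.
by rewrite -size_poly_eq0 sp.
Qed.

Lemma coef0_eq0_mulX {R : nzRingType} {p : {poly R}} :
  p`_0 = 0 -> exists r : {poly R}, p = r * 'X.
Proof.
move=> p0; exists (drop_poly 1 p); rewrite -{1}(poly_take_drop 1 p) expr1.
rewrite [take_poly 1 p]size1_polyC ?size_take_poly //.
by rewrite coef_take_poly p0 add0r.
Qed.

(** Hensel lifting, one coefficient at a time: S + d X^(N+1) has n-th power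
    S^n + n d X^(N+1) modulo X^(N+2), and n is invertible. *)
Lemma nth_root_mod_Xn {K : numFieldType} n N (p : {poly K}) :
  (0 < n)%N -> p`_0 != 0 ->
  exists S : {poly K}, [/\ S`_0 = 1, (size S <= N.+1)%N &
    exists r : {poly K}, p`_0 *: S ^+ n - p = r * 'X^(N.+1)].
Proof.
move=> n0 p0; elim: N => [|N [S [S0 sS [r rE]]]].
  exists 1; split; rewrite ?coefC ?size_poly1 //.
  have [|r rE] := @coef0_eq0_mulX _ (p`_0 *: 1 - p); last by exists r; rewrite expr1n.
  by rewrite coefB coefZ coefC mulr1 subrr.
pose d := - r`_0 / (p`_0 * n%:R); pose S' := S + d *: 'X^(N.+1).
have S'0 : S'`_0 = 1 by rewrite coefD coefZ coefXn mulr0 addr0.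
have sz (q : {poly K}) : q`_0 = q.[0] by rewrite horner_coef0.
have [|r' r'E] := @coef0_eq0_mulX _ (r + (p`_0 * d) *: \sum_(i < n) S' ^+ (n.-1 - i) * S ^+ i).
  rewrite -horner_coef0 hornerD hornerZ horner_sum.
  under eq_bigr => i _ do rewrite hornerM !horner_exp -!sz S'0 S0 !expr1n mulr1.
  rewrite sumr_const card_ord -sz /d; field.
  by rewrite p0 pnatr_eq0 -lt0n n0.
exists S'; split=> //.
  rewrite (leq_trans (size_polyD _ _)) // geq_max (leq_trans sS) //=.
  by rewrite (leq_trans (size_scale_leq _ _)) // size_polyXn.
exists r'; have := subrXX S' S n; rewrite {2}/S' addrAC subrr add0r => SE.
rewrite exprS mulrA -r'E mulrDl -rE.
have -> : p`_0 *: S' ^+ n - p = (p`_0 *: S ^+ n - p) + p`_0 *: (S' ^+ n - S ^+ n).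
  by rewrite scalerBr; ring.
by rewrite SE -!scalerAl scalerA ['X^_ * _]mulrC.
Qed.

(** X^n - b has n distinct roots, because a constant multiple of it and a multiple of
    its derivative n X^(n-1) add up to 1. *)
Lemma distinct_nth_roots {K : numClosedFieldType} n (b : K) :
  b != 0 -> exists2 c : 'I_n -> K, injective c & forall i, c i ^+ n = b.
Proof.
case: n => [|n] b0; first by exists (fun=> 0) => -[].
have mon : 'X^(n.+1) - b%:P \is monic by apply: monicXnsubC.
have [s sE] := closed_field_poly_normal ('X^(n.+1) - b%:P).
rewrite (monicP mon) scale1r in sE.
have ss : size s = n.+1.
  by apply: succn_inj; rewrite -(size_prod_XsubC s id) -sE size_XnsubC.
have us : uniq s.
  rewrite -separable_prod_XsubC -sE unlock derivB derivC subr0 derivXn /=.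
  apply/Bezout_eq1_coprimepP; exists (- (b^-1)%:P, (n.+1%:R * b)^-1 *: 'X) => /=.
  rewrite -scaler_nat -scalerAl -scalerAr scalerA -exprS.
  have -> : (n.+1%:R * b)^-1 * n.+1%:R = b^-1.
    by rewrite invfM mulrC mulrA divff ?mul1r // pnatr_eq0.
  rewrite -mul_polyC mulNr mulrBr -polyCM mulVf //; ring.
exists (fun i => s`_i) => [i j /eqP|i].
  by rewrite nth_uniq ?ss // => /eqP/val_inj.
have : root ('X^(n.+1) - b%:P) s`_i by rewrite sE root_prod_XsubC mem_nth ?ss.
by rewrite rootE !hornerE => /eqP /subr0_eq.
Qed.

End Roots.

Section Substitution.
Context {K : numFieldType}.
Implicit Types (p Q S : {poly K}).

Definition at_zero p := (map_poly (@puiseuxC K) p).[zpow K 1].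

Lemma at_zero1 : at_zero 1 = 1.
Proof. by rewrite /at_zero rmorph1 hornerC. Qed.

Lemma at_zeroB p Q : at_zero (p - Q) = at_zero p - at_zero Q.
Proof. by rewrite /at_zero rmorphB hornerD hornerN. Qed.

Lemma at_zeroM p Q : at_zero (p * Q) = at_zero p * at_zero Q.
Proof. by rewrite /at_zero rmorphM hornerM. Qed.

Lemma at_zeroZ a p : at_zero (a *: p) = puiseuxC a * at_zero p.
Proof. by rewrite /at_zero map_polyZ hornerZ. Qed.

Lemma at_zeroXn k : at_zero 'X^k = zpow K k%:R.
Proof. by rewrite /at_zero map_polyXn hornerXn zpowX mulr1. Qed.

Lemma at_zeroX p k : at_zero (p ^+ k) = at_zero p ^+ k.
Proof. by rewrite /at_zero rmorphXn horner_exp. Qed.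

Lemma at_zero_wide p N : (size p <= N)%N ->
  at_zero p = \sum_(j < N) puiseuxC p`_j * zpow K j%:R.
Proof.
move=> sp; rewrite /at_zero (@horner_coef_wide _ N) ?(leq_trans (size_poly _ _)) //.
by apply: eq_bigr => j _; rewrite coef_map zpowX mulr1.
Qed.

Lemma ord_ge_at_zero b p : (0 < b)%N -> ord_ge (b := b) 0 (at_zero p).
Proof.
move=> b0; rewrite (at_zero_wide _ _ (leqnn _)); apply: ord_ge_sum => j _; apply: ord_geCM.
by rewrite -[j%:R]mulr1 -zpowX; apply: ord_ge_le (ord_geX j (ord_ge_zpow1 b0)); lia.
Qed.

Lemma ord_ge_at_zero_mulXn b N p :
  (0 < b)%N -> ord_ge (b := b) (N%:Z * b%:Z) (at_zero (p * 'X^N)).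
Proof.
move=> b0; rewrite at_zeroM at_zeroXn -[X in ord_ge X _]add0r.
apply: ord_geM; first exact: ord_ge_at_zero.
by rewrite -[N%:R]mulr1 -zpowX; apply: ord_geX; exact: ord_ge_zpow1.
Qed.

Lemma at_inf_rev Q m : (size Q <= m.+1)%N ->
  at_inf Q = zpow K (- m%:R) * at_zero (\poly_(j < m.+1) Q`_(m - j)).
Proof.
move=> sQ; rewrite (at_zero_wide _ _ (size_poly _ _)) mulr_sumr.
rewrite /at_inf (@horner_coef_wide _ m.+1) ?(leq_trans (size_poly _ _)) //.
rewrite (reindex_inj rev_ord_inj); apply: eq_bigr => j _ /=.
rewrite coef_map coef_poly ltn_ord zpowX subSS mulrCA -zpowD.
by rewrite natrB ?leq_ord // mulrN1 opprB addrC.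
Qed.

End Substitution.

Section Main.
Variables (k m q : nat).
Local Notation n := k.+2.
Hypotheses (lt_nm : (n < m)%N) (lt_qm : (n * q < m)%N) (lt_mq : (m < n * q.+1)%N).

(** z^-2 (lam + a / n) as a polynomial in z^(-1/n); the exponents are not truncated
    because n j <= n (q + 1) <= m + 2 n. *)
Definition formal_exponent {K : numFieldType} (c a : K) (S : {poly K}) : {poly K} :=
  \sum_(j < q.+2) (c * S`_j) *: 'X^(m + 2 * n - n * j) + (a / n%:R) *: 'X^(2 * n).

Lemma size_formal_exponent {K : numFieldType} (c a : K) (S : {poly K}) :
  c != 0 -> S`_0 = 1 -> size (formal_exponent c a S) = (m + 2 * n).+1.
Proof.
move=> c0 S0; rewrite /formal_exponent big_ord_recl S0 mulr1 muln0 subn0 -addrA.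
have sX (x : K) N M : (N < M)%N -> (size (x *: 'X^N)%R <= M)%N.
  by move=> NM; rewrite (leq_trans (size_scale_leq _ _)) // size_polyXn.
rewrite size_polyDl size_scale ?size_polyXn // ltnS.
rewrite (leq_trans (size_polyD _ _)) // geq_max; apply/andP; split; last by apply: sX; lia.
rewrite (leq_trans (size_sum _ _ _)) //; apply/bigmax_leqP => j _; apply: sX.
by rewrite lift0; nia.
Qed.

Lemma formal_exponent_at {K : numFieldType} (c a : K) (S : {poly K}) : (size S <= q.+2)%N ->
  (map_poly (@puiseuxC K) (formal_exponent c a S)).[zpow K (- n%:R^-1)] =
  zpow K (- 2) *
    (puiseuxC c * zpow K ((- m%:Z)%:~R / n%:R) * at_zero S + puiseuxC (a / n%:R)).
Proof.
move=> sS; have nQ0 : n%:R != 0 :> rat by rewrite pnatr_eq0.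
rewrite /formal_exponent rmorphD rmorph_sum hornerD horner_sum.
rewrite (at_zero_wide _ _ sS) mulrDr !mulr_sumr; congr (_ + _); last first.
  rewrite /= map_polyZ map_polyXn hornerZ hornerXn zpowX mulrC; congr (zpow K _ * _).
  by rewrite natrM mulrN mulfK.
apply: eq_bigr => j _; rewrite /= map_polyZ map_polyXn hornerZ hornerXn zpowX rmorphM.
have -> : (m + 2 * n - n * j)%N%:R * - n%:R^-1 =
    - 2 + ((- m%:Z)%:~R / n%:R + j%:R) :> rat.
  rewrite natrB; last by have := ltn_ord j; nia.
  by rewrite natrD !natrM intrN; move: (n%:R : rat) nQ0 => x x0; field.
by rewrite !zpowD; ring.
Qed.

Lemma airy_diagonalisation {K : numFieldType} (P Q S r : {poly K}) (c : 'I_n -> K) :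
  size Q = m.+1 -> S`_0 = 1 ->
  injective c -> (forall i, c i ^+ n = Q`_m) ->
  Q`_m *: S ^+ n - \poly_(j < q.+2) Q`_(m - j) = r * 'X^(q.+2) ->
  exists2 U : 'M[puiseux K]_n, U \in unitmx &
    gauge U (airy_mx n P Q) =
    diag_mx (\row_i (zpow K (- 2) * (puiseuxC (c i) * zpow K ((- m%:Z)%:~R / n%:R)
        * at_zero S + puiseuxC (P`_k.+1 / n%:R))))
    + (puiseuxC ((1 - n%:R) / (2 * n%:R) * (n%:R + m%:R)) * zpow K (-1))%:M.
Proof.
move=> sQ S0 c_inj cn Sr.
have n_gt0 : (0 < n)%N by [].
have nK0 : n%:R != 0 :> K by rewrite pnatr_eq0.
have nQ0 : n%:R != 0 :> rat by rewrite pnatr_eq0.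
have Qm0 := coef_last_neq0 sQ.
have c0 i : c i != 0 by apply: contraNneq Qm0 => ci; rewrite -(cn i) ci expr0n.
pose ell i := puiseuxC (c i) * zpow K ((- m%:Z)%:~R / n%:R).
pose lam i := ell i * at_zero S.
have oell i : ord_ge (b := n) (- m%:Z) (ell i) by apply: ord_ge_ell.
have lam_lead i : ord_ge (b := n) (1 - m%:Z) (lam i - ell i).
  have -> : lam i - ell i = ell i * at_zero (S - 1).
    by rewrite at_zeroB at_zero1 mulrBr mulr1.
  have [|r1 ->] := @coef0_eq0_mulX _ (S - 1); first by rewrite coefB coefC S0 subrr.
  apply: ord_ge_le (ord_geM (oell i) (ord_ge_at_zero_mulXn _ 1 r1 n_gt0)); lia.
have lam_root i :
    ord_ge (b := n) (n%:Z + 1 - (n%:Z - 1) * m%:Z) (lam i ^+ n - at_inf Q).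
  rewrite (at_inf_rev _ _ (eq_leq sQ)) /lam exprMn exprMn zpowX -rmorphXn /= cn.
  have -> : n%:R * ((- m%:Z)%:~R / n%:R) = - m%:R :> rat by rewrite intrN mulrC divfK.
  set rev := \poly_(j < m.+1) Q`_(m - j).
  have -> : puiseuxC Q`_m * zpow K (- m%:R) * at_zero S ^+ n - zpow K (- m%:R) * at_zero rev
     = zpow K (- m%:R) * at_zero (Q`_m *: S ^+ n - rev).
    by rewrite at_zeroB at_zeroZ at_zeroX; ring.
  have -> : Q`_m *: S ^+ n - rev = (r - drop_poly q.+2 rev) * 'X^(q.+2).
    have revE : rev = \poly_(j < q.+2) Q`_(m - j) + drop_poly q.+2 rev * 'X^(q.+2).
      rewrite -{1}(poly_take_drop q.+2 rev); congr (_ + _).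
      apply/polyP => j; rewrite coef_take_poly !coef_poly.
      by case: ltnP => // jq; rewrite ifT //; nia.
    by rewrite mulrBl -Sr {1}revE; ring.
  have om : ord_ge (b := n) (- m%:Z * n%:Z) (zpow K (- m%:R)).
    have -> : - m%:R = (- m%:Z * n%:Z)%:~R / n%:R :> rat by rewrite intrM mulfK // intrN.
    exact: ord_ge_zpow.
  apply: ord_ge_le (ord_geM om (ord_ge_at_zero_mulXn _ q.+2 _ n_gt0)).
  by nia.
pose g i := airy_exponent k m P (lam i).
have [y [y1 Ty]] : exists y : 'I_n -> puiseux K,
    (forall i, has_residue (b := n) 1 (y i)) /\ (forall i, airy_op n P Q (g i) (y i) = 0).
  have ex i : exists y, has_residue (b := n) 1 y /\ airy_op n P Q (g i) y = 0.
    have chi0 : n%:R * c i ^+ k.+1 != 0 by rewrite mulf_neq0 ?expf_neq0.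
    have [|y y1 Ty] := @euler_kernel _ n n_gt0 _ _ (n%:Z - (n%:Z - 1) * m%:Z)
      (airy_opB n P Q (g i)) chi0.
      move=> N f; exact: airy_op_expansion lt_nm _ _ _ _ (lam_lead i) (lam_root i) _ _.
    by exists y.
  by have [y yP] := choice ex; exists y; split=> i; have [] := yP i.
(* rho = kappa - kappa', with kappa' = (1 - n)(n + m) / (2 n) the target residue *)
pose rho : rat := (k.+1 * (2 * m + n))%N%:R / (2 * n)%N%:R.
pose V : 'M[puiseux K]_n := \matrix_(i, j) (zpow K rho * iter i (twist (g j)) (y j)).
have uV : V \in unitmx.
  (* row i has order - i m, up to the common factor z^rho *)
  pose d : 'rV[puiseux K]_n := \row_i zpow K (i%:R * (m%:R / n%:R) - rho).
  have : diag_mx d *m V \in unitmx.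
    apply: (@unitmx_of_residues _ n n _ c n_gt0 c_inj) => i j.
    rewrite mul_diag_mx !mxE mulrA -zpowD subrK.
    apply: has_residue_iter_twist => //.
    exact: ord_ge_airy_exponent (lam_lead j).
  by rewrite unitmx_mul => /andP[].
exists (invmx V); first by rewrite unitmx_inv.
apply: gauge_invmx => //; rewrite mulmxDr mul_mx_diag mul_mx_scalar.
apply/matrixP => i j; rewrite !mxE.
under eq_bigr => l _ do rewrite [V l j]mxE mulrCA.
rewrite -mulr_sumr airy_mx_companion // pderivM pderiv_zpow.
set w := iter i _ _; rewrite /g /airy_exponent.
set kappa := _ / (2 * n%:R); set kappa' := _ * (n%:R + m%:R).
have kappaE : kappa = ratr rho + kappa'.
  have nE : n%:R = k.+1%:R + 1 :> K by rewrite natr1.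
  rewrite /kappa /kappa' /rho fmorph_div /= !rmorph_nat !natrM natrD natrM.
  by rewrite nE in nK0 *; move: (k.+1%:R : K) nK0 => x x0; field.
have -> : zpow K (rho - 1) = zpow K rho * zpow K (- 1) by rewrite -zpowD.
have z1 : zpow K (- 2) * zpow K 1 = zpow K (- 1) by rewrite -zpowD.
rewrite kappaE rmorphD /lam /ell -z1; ring.
Qed.

End Main.

Theorem theorem2p4 (R : realType) (n m q s : nat)
    (hm : m = (n * q + s)%N) (hq : (1 <= q)%N) (hs : (0 < s < n)%N) :
  exists F : R[i] -> 'rV[R[i]]_(q.+2) -> 'I_n -> {poly R[i]},
    forall P Q : {poly R[i]},
      P \is monic -> size P = n.+1 -> size Q = m.+1 ->
      let p := F P`_n.-1 (\row_(j < q.+2) Q`_(m - j)%N) in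
      (forall i : 'I_n, size (p i) = (m + 2 * n).+1) /\
      exists2 U : 'M[puiseux R[i]]_n, U \in unitmx &
        gauge U (airy_mx n P Q) =
          diag_mx (\row_(i < n)
            (map_poly (@puiseuxC R[i]) (p i)).[zpow R[i] (- n%:R^-1)])
          + (puiseuxC ((1 - n%:R) / (2 * n%:R) * (n%:R + m%:R))
             * zpow R[i] (-1))%:M.
Proof.
case: n hm hs => [|[|k]] hm hs; [lia|lia|].
have lt_nm : (k.+2 < m)%N by nia.
have lt_qm : (k.+2 * q < m)%N by lia.
have lt_mq : (m < k.+2 * q.+1)%N by nia.
(* One family of roots c and one series S are chosen for each value of the data,
   since F has to be fixed before P and Q. *)
have rootsP (b : R[i]) : exists c : 'I_k.+2 -> R[i],
    b != 0 -> injective c /\ forall i, c i ^+ k.+2 = b.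
  have [->|b0] := eqVneq b 0; first by exists (fun=> 0).
  by have [c c_inj cP] := distinct_nth_roots k.+2 b b0; exists c.
have seriesP (b : 'rV[R[i]]_q.+2) : exists S : {poly R[i]}, b 0 0 != 0 ->
    [/\ S`_0 = 1, (size S <= q.+2)%N &
      exists r : {poly R[i]}, b 0 0 *: S ^+ k.+2 - rVpoly b = r * 'X^(q.+2)].
  have [->|b0] := eqVneq (b 0 0) 0; first by exists 0.
  have b0E : (rVpoly b)`_0 = b 0 0 by rewrite (coef_rVpoly_ord b 0).
  have [|S] := @nth_root_mod_Xn _ k.+2 q.+1 (rVpoly b) isT; first by rewrite b0E.
  by rewrite b0E; exists S.
have [c cP] := choice rootsP; have [S SP] := choice seriesP.
exists (fun a (b : 'rV[R[i]]_q.+2) i =>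
  formal_exponent k m q (c (b 0 0) i) a (S b)) => P Q _ _ sQ /=.
set b := \row_(_ < _) _.
have b0E : b 0 0 = Q`_m by rewrite mxE subn0.
have Qm0 := coef_last_neq0 sQ.
have [|S0 sS [r rE]] := SP b; first by rewrite b0E.
have [c_inj cn] := cP _ Qm0; rewrite b0E in rE *.
split=> [i|].
  apply: size_formal_exponent => //.
  by apply: contraNneq Qm0 => ci; rewrite -(cn i) ci expr0n.
have [|U uU UA] := @airy_diagonalisation k m q lt_nm lt_qm lt_mq _ P Q (S b) r
    (c Q`_m) sQ S0 c_inj cn.
  rewrite -rE; congr (_ - _); apply/polyP => j; rewrite coef_poly coef_rVpoly.
  case: insubP => [j' j'q <-|/negPf->] //=; by rewrite mxE ltn_ord.
exists U => //; rewrite UA; congr (diag_mx _ + _); apply/rowP => i.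
by rewrite !mxE formal_exponent_at.
Qed.
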